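(* Let $A$ and $B$ be formulas of D'.EAK, and let $A'$ and $B'$ be their respective images under the translation into the language of the Dynamic Calculus given in the context, so that $A'\vdash B'$ is a sequent of type $\mathsf{Fm}$ in the language of the Dynamic Calculus. If $A'\vdash B'$ is derivable in the Dynamic Calculus, then $A\vdash B$ is derivable in D'.EAK.
   Context: Both calculi are taken over the same sets of atomic propositions $p$, agents $\mathtt a$, and (functional) actions $\alpha,\beta$, and on a classical propositional base, i.e. with the Grishin rules. For each agent $\mathtt a$ a binary indistinguishability relation on actions is fixed, written $\alpha\mathtt a\beta$, such that $\{\beta\mid\alpha\mathtt a\beta\}$ is finite for each $\alpha$. Notation: an inference is written ''premises / conclusion''; ''//'' marks a rule applicable in both directions. Hatted symbols are structural connectives, unhatted ones operational connectives, and symbols with a tilde are structural connectives called virtual adjoints. **Propositional base (common to both calculi; $X,Y,Z,W$ formula-type structures, $A,B$ formulas).** *Structural rules.* Cut: $X\vdash A,\ A\vdash Y\ /\ X\vdash Y$; $X\vdash Y\ //\ \mathrm I\vdash Y<X$; $X\vdash Y\ //\ X<Y\vdash\mathrm I$; $X\vdash Y\ //\ \mathrm I\vdash X>Y$; $X\vdash Y\ //\ Y>X\vdash\mathrm I$; $\mathrm I\vdash X\ /\ Y\vdash X$; $X\vdash\mathrm I\ /\ X\vdash Y$; $X\vdash Z\ /\ Y\vdash Z<X$; $X\vdash Z\ /\ X<Z\vdash Y$; $X\vdash Z\ /\ Y\vdash X>Z$; $X\vdash Z\ /\ Z>X\vdash Y$; $X;X\vdash Y\ /\ X\vdash Y$;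 $Y\vdash X;X\ /\ Y\vdash X$; $Y;X\vdash Z\ /\ X;Y\vdash Z$; $Z\vdash X;Y\ /\ Z\vdash Y;X$; $X;(Y;Z)\vdash W\ /\ (X;Y);Z\vdash W$; $W\vdash(Z;Y);X\ /\ W\vdash Z;(Y;X)$. Display postulates: $X;Y\vdash Z\ //\ X\vdash Z<Y$; $Z\vdash X;Y\ //\ Z<Y\vdash X$; $X;Y\vdash Z\ //\ Y\vdash X>Z$; $Z\vdash X;Y\ //\ X>Z\vdash Y$. Grishin rules: $X>(Y;Z)\vdash W\ //\ (X>Y);Z\vdash W$; $W\vdash X>(Y;Z)\ //\ W\vdash(X>Y);Z$. *Operational rules and axioms.* $\bot\vdash\mathrm I$; $\mathrm I\vdash\top$; $X\vdash\mathrm I\ /\ X\vdash\bot$; $\mathrm I\vdash X\ /\ \top\vdash X$; $A;B\vdash Z\ /\ A\wedge B\vdash Z$; $X\vdash A,\ Y\vdash B\ /\ X;Y\vdash A\wedge B$; $A\vdash X,\ B\vdash Y\ /\ A\vee B\vdash X;Y$; $Z\vdash A;B\ /\ Z\vdash A\vee B$; $B\vdash Y,\ X\vdash A\ /\ B\leftarrow A\vdash Y<X$; $Z\vdash B<A\ /\ Z\vdash B\leftarrow A$; $B<A\vdash Z\ /\ B\prec A\vdash Z$; $Y\vdash B,\ A\vdash X\ /\ Y<X\vdash B\prec A$; $X\vdash A,\ B\vdash Y\ /\ A\to B\vdash X>Y$; $Z\vdash A>B\ /\ Z\vdash A\to B$; $A>B\vdash Z\ /\ A\succ B\vdash Z$;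 $A\vdash X,\ Y\vdash B\ /\ X>Y\vdash A\succ B$. **D'.EAK.** Formulas: $A::=p\mid\bot\mid\top\mid A\wedge A\mid A\vee A\mid A\to A\mid A\leftarrow A\mid A\succ A\mid A\prec A\mid\langle\mathtt a\rangle A\mid[\mathtt a]A\mid\langle\alpha\rangle A\mid[\alpha]A\mid1_\alpha$. Structures: $X::=A\mid\mathrm I\mid\Phi_\alpha\mid X;X\mid X>X\mid X<X\mid\{s\}X\mid\{s\}^{\smile}X$, where $s$ ranges over agents and actions. Rules: the propositional base; for every agent or action $s$: display postulates $\{s\}X\vdash Y\ //\ X\vdash\{s\}^{\smile}Y$ and $Y\vdash\{s\}X\ //\ \{s\}^{\smile}Y\vdash X$; for $\bullet$ either $\{s\}$ or $\{s\}^{\smile}$, with $\bullet^{\smile}$ denoting the other one: $\mathrm I\vdash X\ /\ \bullet\mathrm I\vdash X$; $X\vdash\mathrm I\ /\ X\vdash\bullet\mathrm I$; $\bullet Y>\bullet Z\vdash X\ /\ \bullet(Y>Z)\vdash X$; $Y\vdash\bullet X>\bullet Z\ /\ Y\vdash\bullet(X>Z)$; $\bullet X;\bullet Y\vdash Z\ /\ \bullet(X;Y)\vdash Z$; $Z\vdash\bullet Y;\bullet X\ /\ Z\vdash\bullet(Y;X)$; $\bullet(X;\bullet^{\smile}Y)\vdash Z\ /\ (\bullet X);Y\vdash Z$; $X\vdash\bullet(Y;\bullet^{\smile}Z)\ /\ X\vdash(\bullet Y);Z$; operational rules $\{s\}A\vdash X\ /\ \langle s\rangle A\vdash X$; $X\vdash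 A\ /\ \{s\}X\vdash\langle s\rangle A$; $A\vdash X\ /\ [s]A\vdash\{s\}X$; $X\vdash\{s\}A\ /\ X\vdash[s]A$. For actions moreover: $\Phi_\alpha\vdash X\ /\ 1_\alpha\vdash X$; axiom $\Phi_\alpha\vdash1_\alpha$; *atom* axioms $\Gamma p\vdash\Delta p$ for $\Gamma,\Delta$ arbitrary finite (possibly empty) sequences of prefixes each of the form $\{\alpha_j\}$ or $\{\alpha_j\}^{\smile}$; *balance* $X\vdash Y\ /\ \{\alpha\}X\vdash\{\alpha\}Y$; *comp* $\{\alpha\}\{\alpha\}^{\smile}X\vdash Y\ /\ \Phi_\alpha;X\vdash Y$ and $X\vdash\{\alpha\}\{\alpha\}^{\smile}Y\ /\ X\vdash\Phi_\alpha>Y$; *reduce* $\Phi_\alpha;\{\alpha\}X\vdash Y\ /\ \{\alpha\}X\vdash Y$ and $Y\vdash\Phi_\alpha>\{\alpha\}X\ /\ Y\vdash\{\alpha\}X$; *swap-in*, for each $\beta$ with $\alpha\mathtt a\beta$: $\{\alpha\}\{\mathtt a\}X\vdash Y\ /\ \Phi_\alpha;\{\mathtt a\}\{\beta\}X\vdash Y$ and $Y\vdash\{\alpha\}\{\mathtt a\}X\ /\ Y\vdash\Phi_\alpha>\{\mathtt a\}\{\beta\}X$; *swap-out*, with one premise for each $\beta$ such that $\alpha\mathtt a\beta$: $(\{\mathtt a\}\{\beta\}X\vdash Y\mid\alpha\mathtt a\beta)\ /\ \{\alpha\}\{\mathtt a\}X\vdash(Y;\cdots;Y)$ and $(Y\vdash\{\mathtt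 a\}\{\beta\}X\mid\alpha\mathtt a\beta)\ /\ (Y;\cdots;Y)\vdash\{\alpha\}\{\mathtt a\}X$, where $(Y;\cdots;Y)$ has $|\{\beta\mid\alpha\mathtt a\beta\}|$ occurrences of $Y$ (and is $\mathrm I$ if this number is $0$). **The Dynamic Calculus.** *Operational terms.* Four pairwise disjoint types: $\mathsf{Fnc}$ consists of the atoms $\alpha$ (the actions); $\mathsf{Ag}$ of the atoms $\mathtt a$; $\mathsf{Act}\ni\gamma::=\mathtt a\blacktriangle_3\alpha\mid\mathtt a\vartriangle_3\alpha$; $\mathsf{Fm}\ni A::= p\mid\bot\mid\top\mid A\wedge A\mid A\vee A\mid A\to A\mid A\leftarrow A\mid A\succ A\mid A\prec A\mid \alpha\,\sharp_0 A\mid\gamma\,\sharp_1 A\mid\mathtt a\,\sharp_2 A$, where $\sharp\in\{\vartriangle,\blacktriangle,\vartriangleright,\blacktriangleright\}$. *Structures.* $\mathsf{FM}\ni X::=A\mid \mathrm I\mid X;X\mid X>X\mid X<X\mid F\,\hat\sharp_0 X\mid\Gamma\,\hat\sharp_1X\mid\mathbf a\,\hat\sharp_2X$ with $\hat\sharp\in\{\hat\vartriangle,\hat\blacktriangle,\hat\vartriangleright,\hat\blacktriangleright\}$; $\mathsf{FNC}\ni F::=\alpha\mid X\tilde\vartriangleleft_0X\mid X\tilde\blacktriangleleft_0X\mid\mathbf a\,\tilde\vartriangleright_3\Gamma\mid\mathbf a\,\tilde\blacktriangleright_3\Gamma$; $\mathsf{ACT}\ni\Gamma::=\gamma\mid\mathbf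 a\,\hat\blacktriangle_3F\mid\mathbf a\,\hat\vartriangle_3F\mid X\hat\vartriangleleft_1X\mid X\hat\blacktriangleleft_1X$; $\mathsf{AG}\ni\mathbf a::=\mathtt a\mid X\tilde\vartriangleleft_2X\mid X\tilde\blacktriangleleft_2X\mid\Gamma\tilde\vartriangleleft_3F\mid\Gamma\tilde\blacktriangleleft_3F$. Below $x,y,z$ are structures and $a,b$ operational terms of the type making the expression well formed. *Rules.* The propositional base, together with: Axioms $\mathtt a\vdash\mathtt a$; $\alpha\vdash\alpha$; *atom*: $F_1\circ_1(F_2\circ_2\cdots(F_n\circ_n p)\cdots)\vdash G_1\rhd_1(G_2\rhd_2\cdots(G_m\rhd_m p)\cdots)$ for $n,m\ge0$, $F_i,G_j\in\mathsf{FNC}$, $\circ_i\in\{\hat\vartriangle_0,\hat\blacktriangle_0\}$, $\rhd_j\in\{\hat\vartriangleright_0,\hat\blacktriangleright_0\}$. Cut rules for each type: $x\vdash a,\ a\vdash y\ /\ x\vdash y$, with $x,a,y$ all of the same type. Operational rules: for $0\le i\le3$, $\sharp\in\{\vartriangle,\blacktriangle\}$: $a\,\hat\sharp_i\,b\vdash z\ /\ a\,\sharp_i\,b\vdash z$; $x\vdash a,\ y\vdash b\ /\ x\,\hat\sharp_i\,y\vdash a\,\sharp_i\,b$. For $0\le i\le2$, $\sharp\in\{\vartriangleright,\blacktriangleright\}$: $x\vdash a,\ B\vdash Y\ /\ a\,\sharp_iB\vdash x\,\hat\sharp_iY$; $Z\vdash a\,\hat\sharp_iB\ /\ Z\vdash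 a\,\sharp_iB$. Display postulates: for $0\le i\le2$: $x\hat\vartriangle_iy\vdash z\ //\ y\vdash x\hat\blacktriangleright_iz$; $x\hat\blacktriangle_iy\vdash z\ //\ y\vdash x\hat\vartriangleright_iz$. For $i=1$: $x\hat\vartriangle_1y\vdash z\ //\ x\vdash z\hat\blacktriangleleft_1y$; $x\hat\blacktriangle_1y\vdash z\ //\ x\vdash z\hat\vartriangleleft_1y$. For $i\in\{0,2,3\}$: $x\hat\vartriangle_iy\vdash z\ //\ x\vdash z\tilde\blacktriangleleft_iy$; $x\hat\blacktriangle_iy\vdash z\ //\ x\vdash z\tilde\vartriangleleft_iy$. For $i=3$: $x\hat\vartriangle_3y\vdash z\ //\ y\vdash x\tilde\blacktriangleright_3z$; $x\hat\blacktriangle_3y\vdash z\ //\ y\vdash x\tilde\vartriangleright_3z$. Necessitation, conjugation, Fischer Servi, monotonicity, for $0\le i\le2$: $\mathrm I\vdash W\ /\ x\hat\vartriangle_i\mathrm I\vdash W$; $\mathrm I\vdash W\ /\ x\hat\blacktriangle_i\mathrm I\vdash W$; $W\vdash\mathrm I\ /\ W\vdash x\hat\vartriangleright_i\mathrm I$; $W\vdash\mathrm I\ /\ W\vdash x\hat\blacktriangleright_i\mathrm I$; $x\hat\vartriangle_i((x\hat\blacktriangle_iY);Z)\vdash W\ /\ Y;(x\hat\vartriangle_iZ)\vdash W$; $x\hat\blacktriangle_i((x\hat\vartriangle_iY);Z)\vdash W\ /\ Y;(x\hat\blacktriangle_iZ)\vdash W$; $W\vdash x\hat\vartriangleright_i((x\hat\blacktriangleright_iY);Z)\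 /\ W\vdash Y;(x\hat\vartriangleright_iZ)$; $W\vdash x\hat\blacktriangleright_i((x\hat\vartriangleright_iY);Z)\ /\ W\vdash Y;(x\hat\blacktriangleright_iZ)$; $(x\hat\vartriangleright_iY)>(x\hat\vartriangle_iZ)\vdash W\ /\ x\hat\vartriangle_i(Y>Z)\vdash W$; $(x\hat\blacktriangleright_iY)>(x\hat\blacktriangle_iZ)\vdash W\ /\ x\hat\blacktriangle_i(Y>Z)\vdash W$; $W\vdash(x\hat\vartriangle_iY)>(x\hat\vartriangleright_iZ)\ /\ W\vdash x\hat\vartriangleright_i(Y>Z)$; $W\vdash(x\hat\blacktriangle_iY)>(x\hat\blacktriangleright_iZ)\ /\ W\vdash x\hat\blacktriangleright_i(Y>Z)$; $(x\hat\vartriangle_iY);(x\hat\vartriangle_iZ)\vdash W\ /\ x\hat\vartriangle_i(Y;Z)\vdash W$; $(x\hat\blacktriangle_iY);(x\hat\blacktriangle_iZ)\vdash W\ /\ x\hat\blacktriangle_i(Y;Z)\vdash W$; $W\vdash(x\hat\vartriangleright_iY);(x\hat\vartriangleright_iZ)\ /\ W\vdash x\hat\vartriangleright_i(Y;Z)$; $W\vdash(x\hat\blacktriangleright_iY);(x\hat\blacktriangleright_iZ)\ /\ W\vdash x\hat\blacktriangleright_i(Y;Z)$. swap-out: $(\mathbf a\hat\blacktriangle_3F)\hat\blacktriangle_1(\mathbf a\hat\blacktriangle_2X)\vdash Y\ /\ \mathbf a\hat\blacktriangle_2(F\hat\blacktriangle_0X)\vdash Y$; $X\vdash(\mathbf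 a\hat\blacktriangle_3F)\hat\blacktriangleright_1(\mathbf a\hat\blacktriangleright_2Y)\ /\ X\vdash\mathbf a\hat\blacktriangleright_2(F\hat\blacktriangleright_0Y)$. swap-in: $\mathbf a\hat\blacktriangle_2(F\hat\blacktriangle_0X)\vdash Y\ /\ (\mathbf a\hat\blacktriangle_3F)\hat\blacktriangle_1(\mathbf a\hat\blacktriangle_2((F\hat\vartriangle_0\mathrm I);X))\vdash Y$; $X\vdash\mathbf a\hat\blacktriangleright_2(F\hat\blacktriangleright_0Y)\ /\ X\vdash(\mathbf a\hat\blacktriangle_3F)\hat\blacktriangleright_1(\mathbf a\hat\blacktriangleright_2((F\hat\vartriangle_0\mathrm I)>Y))$. balance: $X\vdash Y\ /\ F\hat\vartriangle_0X\vdash F\hat\vartriangleright_0Y$, for $F\in\mathsf{FNC}$. **Translation** $A\mapsto A'$ from D'.EAK formulas to terms of type $\mathsf{Fm}$: it is the identity on atomic propositions, commutes with the propositional connectives and constants, and $(\langle\alpha\rangle A)'=\alpha\vartriangle_0A'$, $([\alpha]A)'=\alpha\vartriangleright_0A'$, $(\langle\mathtt a\rangle A)'=\mathtt a\vartriangle_2A'$, $([\mathtt a]A)'=\mathtt a\vartriangleright_2A'$, $(1_\alpha)'=\alpha\vartriangle_0\top$. *)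

(* Defs.v *)
From Stdlib Require Import List.
Import ListNotations.

Set Implicit Arguments.
Unset Strict Implicit.

(** * Sequents, rules, derivability *)

Declare Scope seq_scope.
Delimit Scope seq_scope with seq.
Reserved Notation "X ;; Y" (at level 60, right associativity).
Reserved Notation "X ⊢ Y" (at level 75, no associativity).

(** A calculus is given by its set of rule instances [R premises conclusion]. *)
Inductive derivable (S : Type) (R : list S -> S -> Prop) : S -> Prop :=
| by_rule (ps : list S) (c : S) :
    R ps c -> (forall p, In p ps -> derivable R p) -> derivable R c.

(** * The propositional base *)

Record prop_lang : Type := PropLang {
  fml : Type;
  stc : Type;
  emb : fml -> stc;
  bI : stc;
  bsemi : stc -> stc -> stc;
  bgt : stc -> stc -> stc;
  blt : stc -> stc -> stc;
  fbot : fml;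
  ftop : fml;
  fand : fml -> fml -> fml;
  for_ : fml -> fml -> fml;
  fimp : fml -> fml -> fml;      (* A → B *)
  fpmi : fml -> fml -> fml;      (* B ← A, arguments in the written order *)
  fsucc : fml -> fml -> fml;     (* A ≻ B *)
  fprec : fml -> fml -> fml      (* B ≺ A, arguments in the written order *)
}.

Declare Scope base_scope.
Delimit Scope base_scope with base.
Notation "X ;; Y" := (bsemi X Y) : base_scope.
Notation "X > Y" := (bgt X Y) : base_scope.
Notation "X < Y" := (blt X Y) : base_scope.
Notation "X ⊢ Y" := (@pair (stc _) (stc _) X%base Y%base) : base_scope.

Section Base.
Local Open Scope base_scope.

(** Rules marked "//": each pair may be read in both directions. *)
Inductive base_two_way (L : prop_lang) : stc L * stc L -> stc L * stc L -> Prop :=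
| b2_I_lt_r X Y : base_two_way (X ⊢ Y) (bI L ⊢ Y < X)
| b2_I_lt_l X Y : base_two_way (X ⊢ Y) (X < Y ⊢ bI L)
| b2_I_gt_r X Y : base_two_way (X ⊢ Y) (bI L ⊢ X > Y)
| b2_I_gt_l X Y : base_two_way (X ⊢ Y) (Y > X ⊢ bI L)
| b2_disp_lt_r X Y Z : base_two_way (X ;; Y ⊢ Z) (X ⊢ Z < Y)
| b2_disp_lt_l X Y Z : base_two_way (Z ⊢ X ;; Y) (Z < Y ⊢ X)
| b2_disp_gt_r X Y Z : base_two_way (X ;; Y ⊢ Z) (Y ⊢ X > Z)
| b2_disp_gt_l X Y Z : base_two_way (Z ⊢ X ;; Y) (X > Z ⊢ Y)
| b2_grishin_l X Y Z W : base_two_way (X > (Y ;; Z) ⊢ W) ((X > Y) ;; Z ⊢ W)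
| b2_grishin_r X Y Z W : base_two_way (W ⊢ X > (Y ;; Z)) (W ⊢ (X > Y) ;; Z).

Inductive base_rule (L : prop_lang) : list (stc L * stc L) -> stc L * stc L -> Prop :=
| b_two_way_down p c : base_two_way p c -> base_rule [p] c
| b_two_way_up p c : base_two_way p c -> base_rule [c] p
| b_cut X (A : fml L) Y : base_rule [X ⊢ emb A; emb A ⊢ Y] (X ⊢ Y)
| b_I_weak_l X Y : base_rule [bI L ⊢ X] (Y ⊢ X)
| b_I_weak_r X Y : base_rule [X ⊢ bI L] (X ⊢ Y)
| b_weak_lt_r X Y Z : base_rule [X ⊢ Z] (Y ⊢ Z < X)
| b_weak_lt_l X Y Z : base_rule [X ⊢ Z] (X < Z ⊢ Y)
| b_weak_gt_r X Y Z : base_rule [X ⊢ Z] (Y ⊢ X > Z)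
| b_weak_gt_l X Y Z : base_rule [X ⊢ Z] (Z > X ⊢ Y)
| b_contr_l X Y : base_rule [X ;; X ⊢ Y] (X ⊢ Y)
| b_contr_r X Y : base_rule [Y ⊢ X ;; X] (Y ⊢ X)
| b_exch_l X Y Z : base_rule [Y ;; X ⊢ Z] (X ;; Y ⊢ Z)
| b_exch_r X Y Z : base_rule [Z ⊢ X ;; Y] (Z ⊢ Y ;; X)
| b_assoc_l X Y Z W : base_rule [X ;; (Y ;; Z) ⊢ W] ((X ;; Y) ;; Z ⊢ W)
| b_assoc_r X Y Z W : base_rule [W ⊢ (Z ;; Y) ;; X] (W ⊢ Z ;; (Y ;; X))
| b_bot_l : base_rule [] (emb (fbot L) ⊢ bI L)
| b_top_r : base_rule [] (bI L ⊢ emb (ftop L))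
| b_bot_r X : base_rule [X ⊢ bI L] (X ⊢ emb (fbot L))
| b_top_l X : base_rule [bI L ⊢ X] (emb (ftop L) ⊢ X)
| b_and_l (A B : fml L) Z : base_rule [emb A ;; emb B ⊢ Z] (emb (fand A B) ⊢ Z)
| b_and_r (A B : fml L) X Y :
    base_rule [X ⊢ emb A; Y ⊢ emb B] (X ;; Y ⊢ emb (fand A B))
| b_or_l (A B : fml L) X Y :
    base_rule [emb A ⊢ X; emb B ⊢ Y] (emb (for_ A B) ⊢ X ;; Y)
| b_or_r (A B : fml L) Z : base_rule [Z ⊢ emb A ;; emb B] (Z ⊢ emb (for_ A B))
| b_pmi_l (A B : fml L) X Y :
    base_rule [emb B ⊢ Y; X ⊢ emb A] (emb (fpmi B A) ⊢ Y < X)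
| b_pmi_r (A B : fml L) Z : base_rule [Z ⊢ emb B < emb A] (Z ⊢ emb (fpmi B A))
| b_prec_l (A B : fml L) Z : base_rule [emb B < emb A ⊢ Z] (emb (fprec B A) ⊢ Z)
| b_prec_r (A B : fml L) X Y :
    base_rule [Y ⊢ emb B; emb A ⊢ X] (Y < X ⊢ emb (fprec B A))
| b_imp_l (A B : fml L) X Y :
    base_rule [X ⊢ emb A; emb B ⊢ Y] (emb (fimp A B) ⊢ X > Y)
| b_imp_r (A B : fml L) Z : base_rule [Z ⊢ emb A > emb B] (Z ⊢ emb (fimp A B))
| b_succ_l (A B : fml L) Z : base_rule [emb A > emb B ⊢ Z] (emb (fsucc A B) ⊢ Z)
| b_succ_r (A B : fml L) X Y :
    base_rule [emb A ⊢ X; Y ⊢ emb B] (X > Y ⊢ emb (fsucc A B)).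

End Base.

(** * D'.EAK *)

Inductive label (Ag Ac : Type) : Type := LAg (a : Ag) | LAc (α : Ac).
Arguments LAg {Ag Ac} a.
Arguments LAc {Ag Ac} α.

Inductive eak_fm (P Ag Ac : Type) : Type :=
| EVar (p : P)
| EBot
| ETop
| EAnd (A B : eak_fm P Ag Ac)
| EOr (A B : eak_fm P Ag Ac)
| EImp (A B : eak_fm P Ag Ac)
| EPmi (A B : eak_fm P Ag Ac)    (* A ← B *)
| ESucc (A B : eak_fm P Ag Ac)
| EPrec (A B : eak_fm P Ag Ac)
| EDia (s : label Ag Ac) (A : eak_fm P Ag Ac)
| EBox (s : label Ag Ac) (A : eak_fm P Ag Ac)
| EOne (α : Ac).
Arguments EVar {P Ag Ac} p.
Arguments EBot {P Ag Ac}.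
Arguments ETop {P Ag Ac}.
Arguments EOne {P Ag Ac} α.

(** [Mod fwd s X] is {s}X, and [Mod bwd s X] is {s}˘X. *)
Inductive dirn : Type := fwd | bwd.
Definition opp_dirn (d : dirn) : dirn :=
  match d with fwd => bwd | bwd => fwd end.

Inductive eak_str (P Ag Ac : Type) : Type :=
| EFm (A : eak_fm P Ag Ac)
| EI
| EPhi (α : Ac)
| ESemi (X Y : eak_str P Ag Ac)
| EGt (X Y : eak_str P Ag Ac)
| ELt (X Y : eak_str P Ag Ac)
| Mod (d : dirn) (s : label Ag Ac) (X : eak_str P Ag Ac).
Arguments EI {P Ag Ac}.
Arguments EPhi {P Ag Ac} α.

Definition eak_lang (P Ag Ac : Type) : prop_lang :=
  {| fml := eak_fm P Ag Ac; stc := eak_str P Ag Ac; emb := @EFm P Ag Ac;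
     bI := EI; bsemi := @ESemi P Ag Ac; bgt := @EGt P Ag Ac; blt := @ELt P Ag Ac;
     fbot := EBot; ftop := ETop; fand := @EAnd P Ag Ac; for_ := @EOr P Ag Ac;
     fimp := @EImp P Ag Ac; fpmi := @EPmi P Ag Ac;
     fsucc := @ESucc P Ag Ac; fprec := @EPrec P Ag Ac |}.

Definition enumerates (T : Type) (l : list T) (Q : T -> Prop) : Prop :=
  NoDup l /\ forall x, In x l <-> Q x.

(** [n] occurrences of [Y]; the bracketing is immaterial by associativity and
    exchange. *)
Fixpoint eak_repeat (P Ag Ac : Type) (n : nat) (Y : eak_str P Ag Ac) : eak_str P Ag Ac :=
  match n with
  | 0 => EI
  | 1 => Y
  | S m => ESemi Y (eak_repeat m Y)
  end.

Definition eak_prefix (P Ag Ac : Type) (l : list (dirn * Ac)) (X : eak_str P Ag Ac)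
  : eak_str P Ag Ac :=
  fold_right (fun u Z => Mod (fst u) (LAc (snd u)) Z) X l.

Declare Scope eak_scope.
Delimit Scope eak_scope with eak.
Notation "X ;; Y" := (ESemi X Y) : eak_scope.
Notation "X > Y" := (EGt X Y) : eak_scope.
Notation "X < Y" := (ELt X Y) : eak_scope.
Notation "X ⊢ Y" := (@pair (eak_str _ _ _) (eak_str _ _ _) X%eak Y%eak) : eak_scope.

Section EAK.
Local Open Scope eak_scope.

Inductive eak_two_way (P Ag Ac : Type)
  : eak_str P Ag Ac * eak_str P Ag Ac -> eak_str P Ag Ac * eak_str P Ag Ac -> Prop :=
| e2_disp_l s X Y : eak_two_way (Mod fwd s X ⊢ Y) (X ⊢ Mod bwd s Y)
| e2_disp_r s X Y : eak_two_way (Y ⊢ Mod fwd s X) (Mod bwd s Y ⊢ X).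

(** [R a α β] is the relation α a β. *)
Inductive eak_rule (P Ag Ac : Type) (R : Ag -> Ac -> Ac -> Prop)
  : list (eak_str P Ag Ac * eak_str P Ag Ac) -> eak_str P Ag Ac * eak_str P Ag Ac -> Prop :=
| e_base ps c : @base_rule (eak_lang P Ag Ac) ps c -> eak_rule R ps c
| e_two_way_down p c : eak_two_way p c -> eak_rule R [p] c
| e_two_way_up p c : eak_two_way p c -> eak_rule R [c] p
(* necessitation, Fischer Servi, monotonicity, conjugation *)
| e_nec_l d s X : eak_rule R [EI ⊢ X] (Mod d s EI ⊢ X)
| e_nec_r d s X : eak_rule R [X ⊢ EI] (X ⊢ Mod d s EI)
| e_fs_l d s X Y Z : eak_rule R [Mod d s Y > Mod d s Z ⊢ X] (Mod d s (Y > Z) ⊢ X)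
| e_fs_r d s X Y Z : eak_rule R [Y ⊢ Mod d s X > Mod d s Z] (Y ⊢ Mod d s (X > Z))
| e_mon_l d s X Y Z : eak_rule R [Mod d s X ;; Mod d s Y ⊢ Z] (Mod d s (X ;; Y) ⊢ Z)
| e_mon_r d s X Y Z : eak_rule R [Z ⊢ Mod d s Y ;; Mod d s X] (Z ⊢ Mod d s (Y ;; X))
| e_conj_l d s X Y Z :
    eak_rule R [Mod d s (X ;; Mod (opp_dirn d) s Y) ⊢ Z] (Mod d s X ;; Y ⊢ Z)
| e_conj_r d s X Y Z :
    eak_rule R [X ⊢ Mod d s (Y ;; Mod (opp_dirn d) s Z)] (X ⊢ Mod d s Y ;; Z)
(* operational rules *)
| e_dia_l s A X : eak_rule R [Mod fwd s (EFm A) ⊢ X] (EFm (EDia s A) ⊢ X)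
| e_dia_r s A X : eak_rule R [X ⊢ EFm A] (Mod fwd s X ⊢ EFm (EDia s A))
| e_box_l s A X : eak_rule R [EFm A ⊢ X] (EFm (EBox s A) ⊢ Mod fwd s X)
| e_box_r s A X : eak_rule R [X ⊢ Mod fwd s (EFm A)] (X ⊢ EFm (EBox s A))
| e_one_l α X : eak_rule R [EPhi α ⊢ X] (EFm (EOne α) ⊢ X)
| e_one_r α : eak_rule R [] (EPhi α ⊢ EFm (EOne α))
(* rules specific to actions *)
| e_atom Γ Δ p :
    eak_rule R [] (eak_prefix Γ (EFm (EVar p)) ⊢ eak_prefix Δ (EFm (EVar p)))
| e_balance α X Y :
    eak_rule R [X ⊢ Y] (Mod fwd (LAc α) X ⊢ Mod fwd (LAc α) Y)
| e_comp_l α X Y :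
    eak_rule R [Mod fwd (LAc α) (Mod bwd (LAc α) X) ⊢ Y] (EPhi α ;; X ⊢ Y)
| e_comp_r α X Y :
    eak_rule R [X ⊢ Mod fwd (LAc α) (Mod bwd (LAc α) Y)] (X ⊢ EPhi α > Y)
| e_reduce_l α X Y :
    eak_rule R [EPhi α ;; Mod fwd (LAc α) X ⊢ Y] (Mod fwd (LAc α) X ⊢ Y)
| e_reduce_r α X Y :
    eak_rule R [Y ⊢ EPhi α > Mod fwd (LAc α) X] (Y ⊢ Mod fwd (LAc α) X)
| e_swap_in_l a α β X Y :
    R a α β ->
    eak_rule R [Mod fwd (LAc α) (Mod fwd (LAg a) X) ⊢ Y]
      (EPhi α ;; Mod fwd (LAg a) (Mod fwd (LAc β) X) ⊢ Y)
| e_swap_in_r a α β X Y :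
    R a α β ->
    eak_rule R [Y ⊢ Mod fwd (LAc α) (Mod fwd (LAg a) X)]
      (Y ⊢ EPhi α > Mod fwd (LAg a) (Mod fwd (LAc β) X))
| e_swap_out_l a α (l : list Ac) X Y :
    enumerates l (R a α) ->
    eak_rule R (map (fun β => Mod fwd (LAg a) (Mod fwd (LAc β) X) ⊢ Y) l)
      (Mod fwd (LAc α) (Mod fwd (LAg a) X) ⊢ eak_repeat (length l) Y)
| e_swap_out_r a α (l : list Ac) X Y :
    enumerates l (R a α) ->
    eak_rule R (map (fun β => Y ⊢ Mod fwd (LAg a) (Mod fwd (LAc β) X)) l)
      (eak_repeat (length l) Y ⊢ Mod fwd (LAc α) (Mod fwd (LAg a) X)).

End EAK.

Definition eak_derivable (P Ag Ac : Type) (R : Ag -> Ac -> Ac -> Prop)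
  (X Y : eak_str P Ag Ac) : Prop :=
  derivable (eak_rule R) (X, Y).

(** * The Dynamic Calculus *)

Inductive ty : Type := tFnc | tAct | tAg | tFm.

(** The indices 0, 1, 2 of the connectives with values of type [tFm]. The index 3
    has separate constructors, since its argument and value types differ. *)
Inductive idx : Type := i0 | i1 | i2.
Definition dom (i : idx) : ty :=
  match i with i0 => tFnc | i1 => tAct | i2 => tAg end.

(** White triangles are △, ▷, ◁; black ones are ▲, ▶, ◀. *)
Inductive colour : Type := white | black.
Definition opp (c : colour) : colour :=
  match c with white => black | black => white end.

Inductive term (P Ag Ac : Type) : ty -> Type :=
| AtFnc (α : Ac) : term P Ag Ac tFnc
| AtAg (a : Ag) : term P Ag Ac tAg
| tri3 (c : colour) (a : term P Ag Ac tAg) (α : term P Ag Ac tFnc) : term P Ag Ac tAct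
| AtFm (p : P) : term P Ag Ac tFm
| FBot : term P Ag Ac tFm
| FTop : term P Ag Ac tFm
| FAnd (A B : term P Ag Ac tFm) : term P Ag Ac tFm
| FOr (A B : term P Ag Ac tFm) : term P Ag Ac tFm
| FImp (A B : term P Ag Ac tFm) : term P Ag Ac tFm
| FPmi (A B : term P Ag Ac tFm) : term P Ag Ac tFm    (* A ← B *)
| FSucc (A B : term P Ag Ac tFm) : term P Ag Ac tFm
| FPrec (A B : term P Ag Ac tFm) : term P Ag Ac tFm
| tri (c : colour) (i : idx) (a : term P Ag Ac (dom i)) (A : term P Ag Ac tFm)
  : term P Ag Ac tFm
| rarr (c : colour) (i : idx) (a : term P Ag Ac (dom i)) (A : term P Ag Ac tFm)
  : term P Ag Ac tFm.
Arguments AtFnc {P Ag Ac} α.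
Arguments AtAg {P Ag Ac} a.
Arguments AtFm {P Ag Ac} p.
Arguments FBot {P Ag Ac}.
Arguments FTop {P Ag Ac}.
Arguments tri {P Ag Ac} c i a A.
Arguments rarr {P Ag Ac} c i a A.
Arguments tri3 {P Ag Ac} c a α.

(** [Larr] is virtual for the indices 0 and 2; [Rarr3] and [Larr3] are virtual. *)
Inductive str (P Ag Ac : Type) : ty -> Type :=
| Op (t : ty) (a : term P Ag Ac t) : str P Ag Ac t
| SI : str P Ag Ac tFm
| SSemi (X Y : str P Ag Ac tFm) : str P Ag Ac tFm
| SGt (X Y : str P Ag Ac tFm) : str P Ag Ac tFm
| SLt (X Y : str P Ag Ac tFm) : str P Ag Ac tFm
| Tri (c : colour) (i : idx) (x : str P Ag Ac (dom i)) (Y : str P Ag Ac tFm)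
  : str P Ag Ac tFm
| Rarr (c : colour) (i : idx) (x : str P Ag Ac (dom i)) (Y : str P Ag Ac tFm)
  : str P Ag Ac tFm
| Larr (c : colour) (i : idx) (Z Y : str P Ag Ac tFm) : str P Ag Ac (dom i)
| Tri3 (c : colour) (x : str P Ag Ac tAg) (F : str P Ag Ac tFnc) : str P Ag Ac tAct
| Rarr3 (c : colour) (x : str P Ag Ac tAg) (Γ : str P Ag Ac tAct) : str P Ag Ac tFnc
| Larr3 (c : colour) (Γ : str P Ag Ac tAct) (F : str P Ag Ac tFnc) : str P Ag Ac tAg.
Arguments SI {P Ag Ac}.
Arguments Tri {P Ag Ac} c i x Y.
Arguments Rarr {P Ag Ac} c i x Y.
Arguments Larr {P Ag Ac} c i Z Y.
Arguments Tri3 {P Ag Ac} c x F.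
Arguments Rarr3 {P Ag Ac} c x Γ.
Arguments Larr3 {P Ag Ac} c Γ F.

Inductive dc_seq (P Ag Ac : Type) : Type :=
| DSeq (t : ty) (x y : str P Ag Ac t).

Definition dc_lang (P Ag Ac : Type) : prop_lang :=
  {| fml := term P Ag Ac tFm; stc := str P Ag Ac tFm; emb := @Op P Ag Ac tFm;
     bI := SI; bsemi := @SSemi P Ag Ac; bgt := @SGt P Ag Ac; blt := @SLt P Ag Ac;
     fbot := FBot; ftop := FTop; fand := @FAnd P Ag Ac; for_ := @FOr P Ag Ac;
     fimp := @FImp P Ag Ac; fpmi := @FPmi P Ag Ac;
     fsucc := @FSucc P Ag Ac; fprec := @FPrec P Ag Ac |}.

Definition fm_seq (P Ag Ac : Type) (s : str P Ag Ac tFm * str P Ag Ac tFm)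
  : dc_seq P Ag Ac :=
  DSeq (fst s) (snd s).

Definition tri_prefix (P Ag Ac : Type) (l : list (colour * str P Ag Ac tFnc))
  (X : str P Ag Ac tFm) : str P Ag Ac tFm :=
  fold_right (fun u Z => Tri (fst u) i0 (snd u) Z) X l.

Definition rarr_prefix (P Ag Ac : Type) (l : list (colour * str P Ag Ac tFnc))
  (X : str P Ag Ac tFm) : str P Ag Ac tFm :=
  fold_right (fun u Z => Rarr (fst u) i0 (snd u) Z) X l.

Declare Scope dc_scope.
Delimit Scope dc_scope with dc.
Notation "X ;; Y" := (SSemi X Y) : dc_scope.
Notation "X > Y" := (SGt X Y) : dc_scope.
Notation "X < Y" := (SLt X Y) : dc_scope.
Notation "X ⊢ Y" := (DSeq X%dc Y%dc) : dc_scope.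

Section DC.
Local Open Scope dc_scope.

(** Display postulates; the residuals of △ are black, those of ▲ white. *)
Inductive dc_two_way (P Ag Ac : Type) : dc_seq P Ag Ac -> dc_seq P Ag Ac -> Prop :=
| d2_right c i x Y Z : dc_two_way (Tri c i x Y ⊢ Z) (Y ⊢ Rarr (opp c) i x Z)
| d2_left c i x Y Z : dc_two_way (Tri c i x Y ⊢ Z) (x ⊢ Larr (opp c) i Z Y)
| d2_right3 c x F Γ : dc_two_way (Tri3 c x F ⊢ Γ) (F ⊢ Rarr3 (opp c) x Γ)
| d2_left3 c x F Γ : dc_two_way (Tri3 c x F ⊢ Γ) (x ⊢ Larr3 (opp c) Γ F).

Inductive dc_rule (P Ag Ac : Type) : list (dc_seq P Ag Ac) -> dc_seq P Ag Ac -> Prop :=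
| d_base ps c :
    @base_rule (dc_lang P Ag Ac) ps c -> dc_rule (map (@fm_seq P Ag Ac) ps) (fm_seq c)
| d_two_way_down p c : dc_two_way p c -> dc_rule [p] c
| d_two_way_up p c : dc_two_way p c -> dc_rule [c] p
| d_ax_ag a : dc_rule [] (Op (AtAg a) ⊢ Op (AtAg a))
| d_ax_fnc α : dc_rule [] (Op (AtFnc α) ⊢ Op (AtFnc α))
| d_atom Fs Gs p :
    dc_rule [] (tri_prefix Fs (Op (AtFm p)) ⊢ rarr_prefix Gs (Op (AtFm p)))
| d_cut t (x : str P Ag Ac t) (a : term P Ag Ac t) (y : str P Ag Ac t) :
    dc_rule [x ⊢ Op a; Op a ⊢ y] (x ⊢ y)
(* operational rules *)
| d_tri_l c i a B Z : dc_rule [Tri c i (Op a) (Op B) ⊢ Z] (Op (tri c i a B) ⊢ Z)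
| d_tri_r c i x a Y B :
    dc_rule [x ⊢ Op a; Y ⊢ Op B] (Tri c i x Y ⊢ Op (tri c i a B))
| d_tri3_l c a b Γ : dc_rule [Tri3 c (Op a) (Op b) ⊢ Γ] (Op (tri3 c a b) ⊢ Γ)
| d_tri3_r c x a F b :
    dc_rule [x ⊢ Op a; F ⊢ Op b] (Tri3 c x F ⊢ Op (tri3 c a b))
| d_rarr_l c i x a Y B :
    dc_rule [x ⊢ Op a; Op B ⊢ Y] (Op (rarr c i a B) ⊢ Rarr c i x Y)
| d_rarr_r c i a B Z : dc_rule [Z ⊢ Rarr c i (Op a) (Op B)] (Z ⊢ Op (rarr c i a B))
(* necessitation *)
| d_nec_l c i x W : dc_rule [SI ⊢ W] (Tri c i x SI ⊢ W)
| d_nec_r c i x W : dc_rule [W ⊢ SI] (W ⊢ Rarr c i x SI)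
(* conjugation *)
| d_conj_l c i x Y Z W :
    dc_rule [Tri c i x (Tri (opp c) i x Y ;; Z) ⊢ W] (Y ;; Tri c i x Z ⊢ W)
| d_conj_r c i x Y Z W :
    dc_rule [W ⊢ Rarr c i x (Rarr (opp c) i x Y ;; Z)] (W ⊢ Y ;; Rarr c i x Z)
(* Fischer Servi *)
| d_fs_l c i x Y Z W :
    dc_rule [Rarr c i x Y > Tri c i x Z ⊢ W] (Tri c i x (Y > Z) ⊢ W)
| d_fs_r c i x Y Z W :
    dc_rule [W ⊢ Tri c i x Y > Rarr c i x Z] (W ⊢ Rarr c i x (Y > Z))
(* monotonicity *)
| d_mon_l c i x Y Z W :
    dc_rule [Tri c i x Y ;; Tri c i x Z ⊢ W] (Tri c i x (Y ;; Z) ⊢ W)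
| d_mon_r c i x Y Z W :
    dc_rule [W ⊢ Rarr c i x Y ;; Rarr c i x Z] (W ⊢ Rarr c i x (Y ;; Z))
(* interaction of agents and actions *)
| d_swap_out_l (x : str P Ag Ac tAg) (F : str P Ag Ac tFnc) X Y :
    dc_rule [Tri black i1 (Tri3 black x F) (Tri black i2 x X) ⊢ Y]
      (Tri black i2 x (Tri black i0 F X) ⊢ Y)
| d_swap_out_r (x : str P Ag Ac tAg) (F : str P Ag Ac tFnc) X Y :
    dc_rule [X ⊢ Rarr black i1 (Tri3 black x F) (Rarr black i2 x Y)]
      (X ⊢ Rarr black i2 x (Rarr black i0 F Y))
| d_swap_in_l (x : str P Ag Ac tAg) (F : str P Ag Ac tFnc) X Y :
    dc_rule [Tri black i2 x (Tri black i0 F X) ⊢ Y]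
      (Tri black i1 (Tri3 black x F) (Tri black i2 x (Tri white i0 F SI ;; X)) ⊢ Y)
| d_swap_in_r (x : str P Ag Ac tAg) (F : str P Ag Ac tFnc) X Y :
    dc_rule [X ⊢ Rarr black i2 x (Rarr black i0 F Y)]
      (X ⊢ Rarr black i1 (Tri3 black x F) (Rarr black i2 x (Tri white i0 F SI > Y)))
| d_balance (F : str P Ag Ac tFnc) X Y :
    dc_rule [X ⊢ Y] (Tri white i0 F X ⊢ Rarr white i0 F Y).

End DC.

Definition dc_derivable (P Ag Ac : Type) (t : ty) (x y : str P Ag Ac t) : Prop :=
  derivable (@dc_rule P Ag Ac) (DSeq x y).

(** * The translation *)

Fixpoint translate (P Ag Ac : Type) (A : eak_fm P Ag Ac) : term P Ag Ac tFm :=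
  match A with
  | EVar p => AtFm p
  | EBot => FBot
  | ETop => FTop
  | EAnd A B => FAnd (translate A) (translate B)
  | EOr A B => FOr (translate A) (translate B)
  | EImp A B => FImp (translate A) (translate B)
  | EPmi A B => FPmi (translate A) (translate B)
  | ESucc A B => FSucc (translate A) (translate B)
  | EPrec A B => FPrec (translate A) (translate B)
  | EDia (LAc α) A => tri white i0 (AtFnc α) (translate A)
  | EBox (LAc α) A => rarr white i0 (AtFnc α) (translate A)
  | EDia (LAg a) A => tri white i2 (AtAg a) (translate A)
  | EBox (LAg a) A => rarr white i2 (AtAg a) (translate A)
  | EOne α => tri white i0 (AtFnc α) FTop
  end.

(* Main.v *)
(** Kripke semantics mediates between the calculi. The formulas of D'.EAK form a Boolean
    algebra with operators, whose prime filters are the worlds of a canonical model: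
    the accessibility relations of actions are functional and preserve atoms, swap-in
    and swap-out become confluence conditions between action and agent relations, and
    truth at a world is membership. In a model with these properties the Dynamic
    Calculus is sound, the black connectives being read along the converse relations.
    The virtual adjoints are harmless because structures are read differently in
    precedent and in succedent position, and denote genuine residuals only in the latter. *)

Require Import Defs.
From Stdlib Require Import List Classical FunctionalExtensionality PropExtensionality.
From mathcomp Require classical_sets.
Import ListNotations.

Set Implicit Arguments.
Unset Strict Implicit.

(** * Kripke semantics of the Dynamic Calculus *)

Section Kripke.

Variables (P Ag Ac : Type) (R : Ag -> Ac -> Ac -> Prop).
Variables (W : Type) (acc : label Ag Ac -> W -> W -> Prop) (V : P -> W -> Prop).

Definition den (t : ty) : Type :=
  match t with tFnc => Ac | tAct => Ac | tAg => Ag | tFm => W end.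

Definition step (i : idx) : den (dom i) -> W -> W -> Prop :=
  match i with
  | i0 => fun α => acc (LAc α)
  | i1 => fun β => acc (LAc β)
  | i2 => fun a => acc (LAg a)
  end.

Definition along (c : colour) (i : idx) (d : den (dom i)) (u v : W) : Prop :=
  match c with white => step d u v | black => step d v u end.

(* An element of type Act denotes a set of actions: both [a △3 α] and [a ▲3 α] are
   read as {β | α a β}; no rule constrains the former. *)
Fixpoint tden (t : ty) (a : term P Ag Ac t) : den t -> Prop :=
  match a in term _ _ _ t return den t -> Prop with
  | AtFnc α => fun d => d = α
  | AtAg a => fun d => d = a
  | tri3 _ a α => fun β => exists a' α', tden a a' /\ tden α α' /\ R a' α' β
  | AtFm p => V p
  | FBot => fun _ => False
  | FTop => fun _ => True
  | FAnd A B => fun u => tden A u /\ tden B u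
  | FOr A B => fun u => tden A u \/ tden B u
  | FImp A B => fun u => tden A u -> tden B u
  | FPmi A B => fun u => tden B u -> tden A u
  | FSucc A B => fun u => tden B u /\ ~ tden A u
  | FPrec A B => fun u => tden A u /\ ~ tden B u
  | tri c i a A => fun u => exists d v, tden a d /\ along c d u v /\ tden A v
  | rarr c i a A => fun u => forall d v, tden a d -> along c d u v -> tden A v
  end.

(* [sden false] and [sden true] read a structure in precedent and in succedent
   position. A residual in precedent position can only come from weakening or from an
   axiom scheme with arbitrary parameters, so the empty set is a sound reading of it.
   This is what makes every precedent of type Fnc or Ag at most a singleton, although
   the virtual adjoints have no singleton-valued interpretation. *)
Fixpoint sden (t : ty) (X : str P Ag Ac t) (suc : bool) : den t -> Prop :=
  match X in str _ _ _ t return den t -> Prop with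
  | Op _ a => tden a
  | SI => fun _ => suc = false
  | SSemi X Y => fun u =>
      if suc then sden X suc u \/ sden Y suc u else sden X suc u /\ sden Y suc u
  | SGt X Y => fun u =>
      if suc then sden X false u -> sden Y true u else sden Y false u /\ ~ sden X true u
  | SLt X Y => fun u =>
      if suc then sden Y false u -> sden X true u else sden X false u /\ ~ sden Y true u
  | Tri c i x Y => fun u =>
      if suc then False else exists d v, sden x false d /\ along c d u v /\ sden Y false v
  | Rarr c i x Y => fun u =>
      if suc then forall d v, sden x false d -> along c d u v -> sden Y true v else False
  | Larr c i Z Y => fun d =>
      if suc then forall u v, along c d v u -> sden Y false v -> sden Z true u else False
  | Tri3 _ x F => fun β =>
      if suc then False else exists a α, sden x false a /\ sden F false α /\ R a α β
  | Rarr3 _ x Γ => fun α =>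
      if suc then forall a β, sden x false a -> R a α β -> sden Γ true β else False
  | Larr3 _ Γ F => fun a =>
      if suc then forall α β, sden F false α -> R a α β -> sden Γ true β else False
  end.

Definition valid (s : dc_seq P Ag Ac) : Prop :=
  match s with DSeq _ x y => forall d, sden x false d -> sden y true d end.

Definition pair_valid (s : str P Ag Ac tFm * str P Ag Ac tFm) : Prop :=
  forall u, sden (fst s) false u -> sden (snd s) true u.

Lemma along_oppD c i (d : den (dom i)) u v : along (opp c) d u v -> along c d v u.
Proof. destruct c; trivial. Qed.

Lemma along_oppI c i (d : den (dom i)) u v : along c d v u -> along (opp c) d u v.
Proof. destruct c; trivial. Qed.

(** In types Fnc and Ag only atoms are non-empty as precedents, and an atom denotes a singleton.
    Swap-in and balance repeat a structure in their conclusion, and soundness needs both occurrences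
    to pick the same action or agent. *)
Lemma precedent_unique t (X : str P Ag Ac t) d d' :
  t = tFnc \/ t = tAg -> sden X false d -> sden X false d' -> d = d'.
Proof.
  intros Ht; destruct X as [t a| | | | | | | | | |]; [destruct a|..]; simpl;
    try (destruct Ht; discriminate); try contradiction; congruence.
Qed.

Lemma base_two_way_valid p c :
  @base_two_way (dc_lang P Ag Ac) p c -> (pair_valid p <-> pair_valid c).
Proof.
  intros H; destruct H; unfold pair_valid; simpl;
    split; intros H u; specialize (H u);
    (* Every reading at [u] becomes a propositional variable equipped with its excluded middle, so
       that residuation and the Grishin rules reduce to classical tautologies. *)
    repeat match goal with
      | |- context [@sden ?t ?X ?b u] =>
          let h := fresh in pose proof (classic (@sden t X b u)) as h; revert h;
          let q := fresh in set (q := @sden t X b u) in *; clearbody q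
      end; try tauto; intuition congruence.
Qed.

Lemma base_rule_valid ps c :
  @base_rule (dc_lang P Ag Ac) ps c -> Forall pair_valid ps -> pair_valid c.
Proof.
  intros H Hps; destruct H;
    try (apply (base_two_way_valid H); inversion Hps; assumption);
    repeat match goal with
      | H : Forall _ (_ :: _) |- _ => inversion_clear H
      | H : Forall _ [] |- _ => clear H
      end;
    unfold pair_valid in *; simpl in *; intros u;
    repeat match goal with H : forall _, _ -> _ |- _ => specialize (H u) end;
    try tauto; intuition congruence.
Qed.

(** * Soundness under the frame conditions *)

Hypothesis acc_functional :
  forall α u v w, acc (LAc α) u v -> acc (LAc α) u w -> v = w.
Hypothesis acc_atom : forall α p u v, acc (LAc α) u v -> (V p u <-> V p v).
Hypothesis acc_swap_out : forall a α u v w, acc (LAc α) u v -> acc (LAg a) v w ->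
  exists β v', R a α β /\ acc (LAg a) u v' /\ acc (LAc β) v' w.
(** The world [t] only records that α is executable at [u], which is what [F △ I] contributes to the
    conclusion of swap-in. *)
Hypothesis acc_swap_in : forall a α β u v w t, R a α β -> acc (LAg a) u v ->
  acc (LAc β) v w -> acc (LAc α) u t -> exists v', acc (LAc α) u v' /\ acc (LAg a) v' w.

(** A displayed structure keeps its polarity, and a residual is introduced only as a whole
    succedent, where it has its genuine meaning. *)
Lemma dc_two_way_valid (p c : dc_seq P Ag Ac) : dc_two_way p c -> (valid p <-> valid c).
Proof.
  intros H; destruct H; simpl; split; intros H.
  - intros v Hv d u Hd Huv; apply along_oppD in Huv; apply H; eauto 7.
  - intros u (d & v & Hd & Huv & Hv); apply (H v Hv d u Hd), along_oppI, Huv.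
  - intros d Hd u v Huv Hv; apply along_oppD in Huv; apply H; eauto 7.
  - intros u (d & v & Hd & Huv & Hv); apply (H d Hd u v); [apply along_oppI, Huv|exact Hv].
  - intros; apply H; eauto 7.
  - intros β (a & α & ? & ? & ?); eauto.
  - intros; apply H; eauto 7.
  - intros β (a & α & ? & ? & ?); eauto.
Qed.

(** Whatever the [Fs] denote, each prefix follows an action edge forwards or backwards, and
    [acc_atom] makes atoms invariant both ways. *)
Lemma tri_prefix_atom Fs p u :
  sden (tri_prefix Fs (Op (AtFm p))) false u -> V p u.
Proof.
  revert u; induction Fs as [|[c F] Fs IH]; simpl; intros u; [trivial|].
  intros (α & v & _ & Huv & Hv); apply IH in Hv.
  destruct c; simpl in Huv; eapply acc_atom in Huv; apply Huv; exact Hv.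
Qed.

Lemma rarr_prefix_atom Gs p u :
  V p u -> sden (rarr_prefix Gs (Op (AtFm p))) true u.
Proof.
  revert u; induction Gs as [|[c F] Gs IH]; simpl; intros u Hu; [exact Hu|].
  intros α v _ Huv; apply IH.
  destruct c; simpl in Huv; eapply acc_atom in Huv; apply Huv; exact Hu.
Qed.

Lemma dc_rule_valid (ps : list (dc_seq P Ag Ac)) c :
  dc_rule ps c -> Forall valid ps -> valid c.
Proof.
  intros H Hps; destruct H;
    repeat match goal with
      | H : Forall _ (_ :: _) |- _ => let Hp := fresh "Hp" in inversion_clear H as [|? ? Hp]
      | H : Forall _ [] |- _ => clear H
      end;
    try match goal with H : dc_two_way _ _ |- _ =>
      apply (dc_two_way_valid H); assumption end; simpl in *.
  - refine (base_rule_valid H _); revert Hps; clear.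
    induction ps; simpl; intros H; inversion_clear H; constructor; auto.
  - auto.
  - auto.
  - intros u Hu; eapply rarr_prefix_atom, tri_prefix_atom, Hu.
  - auto.
  - auto.
  - intros u (d & v & ? & ? & ?); eauto 7.
  - auto.
  - intros u (d & v & ? & ? & ?); eauto 7.
  - eauto.
  - auto.
  - intros u (d & v & ? & ? & ?); auto.
  (* [SI] is empty in succedent position, so the premise leaves no world in the precedent. *)
  - intros u Hu ; exfalso; specialize (Hp u Hu); discriminate.
  - intros u (Hu & d & v & Hd & Huv & Hv). apply Hp; exists d, v; repeat split; auto.
    exists d, u; repeat split; auto; apply along_oppI; auto.
  (* The residual of opposite colour at [v] looks back at [u], so it can only hold if [Y] already
     does. *)
  - intros u Hu; destruct (classic (sden Y true u)) as [|HY]; [auto|right].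
    intros d v Hd Huv; destruct (Hp u Hu d v Hd Huv) as [H|H]; [|exact H].
    contradict HY; apply (H d u Hd), along_oppI, Huv.
  - intros u (d & v & Hd & Huv & Hv & HY). apply Hp; split; [eauto 7|].
    intros H; apply HY; eauto.
  - intros u Hu d v Hd Huv HY; apply (Hp u Hu) with d; eauto 7.
  - intros u (d & v & Hd & Huv & HY & HZ). apply Hp; eauto 10.
  - intros u Hu d v Hd Huv; destruct (Hp u Hu) as [H|H]; eauto.
  (* Black connectives run backwards: [w] reaches [u] by an α-edge and then an agent edge, and the
     path is rerouted as an agent edge followed by a β-edge. *)
  - intros u (a & v & Ha & Huv & α & w & Hα & Hvw & Hw).
    destruct (acc_swap_out Hvw Huv) as (β & v' & HR & H1 & H2).
    apply Hp; exists β, v'; split; [eauto 7|]; split; [exact H2|]; exists a, w; auto.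
  - intros u Hu a v Ha Huv α w Hα Hvw.
    destruct (acc_swap_out Hvw Huv) as (β & v' & HR & H1 & H2).
    apply (Hp u Hu β v') with a; eauto 7.
  - intros u (β & v & (a & α & Ha & Hα & HR) & Huv & a' & w & Ha' & Hvw & (α' & t & Hα' & Hwt & _) & Hw).
    rewrite (precedent_unique (or_intror eq_refl) Ha' Ha) in *.
    rewrite (precedent_unique (or_introl eq_refl) Hα' Hα) in *.
    destruct (acc_swap_in HR Hvw Huv Hwt) as (v' & H1 & H2).
    apply Hp; exists a, v'; repeat split; auto; exists α, w; auto.
  - intros u Hu β v (a & α & Ha & Hα & HR) Huv a' w Ha' Hvw (α' & t & Hα' & Hwt & _).
    rewrite (precedent_unique (or_intror eq_refl) Ha' Ha) in *.
    rewrite (precedent_unique (or_introl eq_refl) Hα' Hα) in *.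
    destruct (acc_swap_in HR Hvw Huv Hwt) as (v' & H1 & H2).
    apply (Hp u Hu a v' Ha H2 α w Hα H1).
  - intros u (α & v & Hα & Huv & Hv) α' w Hα' Huw.
    rewrite (precedent_unique (or_introl eq_refl) Hα' Hα) in *.
    rewrite (acc_functional Huw Huv); auto.
Qed.

Lemma dc_sound (s : dc_seq P Ag Ac) : derivable (@dc_rule P Ag Ac) s -> valid s.
Proof.
  induction 1 as [ps c Hr _ IH]. apply (dc_rule_valid Hr), Forall_forall, IH.
Qed.

End Kripke.

(** * Boolean and modal laws of D'.EAK *)

Section EAKTheory.

Variables (P Ag Ac : Type) (R : Ag -> Ac -> Ac -> Prop).

Notation fm := (eak_fm P Ag Ac).
Notation st := (eak_str P Ag Ac).
Notation "X ⊩ Y" := (@eak_derivable P Ag Ac R X%eak Y%eak) (at level 75).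
Notation "A ≤ B" := (EFm A ⊩ EFm B) (at level 75).

Implicit Types (X Y Z W : st) (A B C : fm).

(** * Derived structural and logical rules *)

Lemma rule0 X Y : eak_rule R [] (X, Y) -> X ⊩ Y.
Proof. intros H; apply (by_rule H); intros p []. Qed.

Lemma rule1 X Y X' Y' : eak_rule R [(X, Y)] (X', Y') -> X ⊩ Y -> X' ⊩ Y'.
Proof. intros H H1; apply (by_rule H); intros p [<-|[]]; exact H1. Qed.

Lemma rule2 X1 Y1 X2 Y2 X Y :
  eak_rule R [(X1, Y1); (X2, Y2)] (X, Y) -> X1 ⊩ Y1 -> X2 ⊩ Y2 -> X ⊩ Y.
Proof. intros H H1 H2; apply (by_rule H); intros p [<-|[<-|[]]]; assumption. Qed.

Notation L := (eak_lang P Ag Ac).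

Lemma display X Y X' Y' :
  @base_two_way L (X, Y) (X', Y') -> (X ⊩ Y <-> X' ⊩ Y').
Proof.
  intros H; split; apply rule1, e_base; [apply b_two_way_down|apply b_two_way_up]; exact H.
Qed.

Lemma disp_lt_r X Y Z : X ;; Y ⊩ Z <-> X ⊩ Z < Y.
Proof. exact (display (b2_disp_lt_r (L := L) X Y Z)). Qed.
Lemma disp_gt_r X Y Z : X ;; Y ⊩ Z <-> Y ⊩ X > Z.
Proof. exact (display (b2_disp_gt_r (L := L) X Y Z)). Qed.
Lemma disp_lt_l X Y Z : Z ⊩ X ;; Y <-> Z < Y ⊩ X.
Proof. exact (display (b2_disp_lt_l (L := L) X Y Z)). Qed.
Lemma disp_gt_l X Y Z : Z ⊩ X ;; Y <-> X > Z ⊩ Y.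
Proof. exact (display (b2_disp_gt_l (L := L) X Y Z)). Qed.

Lemma mod_disp_l s X Y : Mod fwd s X ⊩ Y <-> X ⊩ Mod bwd s Y.
Proof. split; apply rule1; [apply e_two_way_down|apply e_two_way_up]; constructor. Qed.

Lemma mod_disp_r s X Y : Y ⊩ Mod fwd s X <-> Mod bwd s Y ⊩ X.
Proof. split; apply rule1; [apply e_two_way_down|apply e_two_way_up]; constructor. Qed.

Lemma base0 X Y : @base_rule L [] (X, Y) -> X ⊩ Y.
Proof. intros H; apply rule0, e_base, H. Qed.

Lemma base1 X Y X' Y' : @base_rule L [(X, Y)] (X', Y') -> X ⊩ Y -> X' ⊩ Y'.
Proof. intros H; apply rule1, e_base, H. Qed.

Lemma base2 X1 Y1 X2 Y2 X Y :
  @base_rule L [(X1, Y1); (X2, Y2)] (X, Y) -> X1 ⊩ Y1 -> X2 ⊩ Y2 -> X ⊩ Y.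
Proof. intros H; apply rule2, e_base, H. Qed.

Lemma cut A X Y : X ⊩ EFm A -> EFm A ⊩ Y -> X ⊩ Y.
Proof. exact (base2 (b_cut (L := L) X A Y)). Qed.

Lemma exch_l X Y Z : Y ;; X ⊩ Z -> X ;; Y ⊩ Z.
Proof. exact (base1 (b_exch_l (L := L) X Y Z)). Qed.

Lemma exch_r X Y Z : Z ⊩ X ;; Y -> Z ⊩ Y ;; X.
Proof. exact (base1 (b_exch_r (L := L) X Y Z)). Qed.

Lemma contr_l X Y : X ;; X ⊩ Y -> X ⊩ Y.
Proof. exact (base1 (b_contr_l (L := L) X Y)). Qed.

Lemma contr_r X Y : Y ⊩ X ;; X -> Y ⊩ X.
Proof. exact (base1 (b_contr_r (L := L) X Y)). Qed.

Lemma I_weak_l X Y : EI ⊩ X -> Y ⊩ X.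
Proof. exact (base1 (b_I_weak_l (L := L) X Y)). Qed.

Lemma I_weak_r X Y : X ⊩ EI -> X ⊩ Y.
Proof. exact (base1 (b_I_weak_r (L := L) X Y)). Qed.

Lemma weak_l1 X Y Z : X ⊩ Z -> X ;; Y ⊩ Z.
Proof. intros H; apply disp_gt_r; exact (base1 (b_weak_gt_r (L := L) X Y Z) H). Qed.

Lemma weak_l2 X Y Z : Y ⊩ Z -> X ;; Y ⊩ Z.
Proof. intros H; apply exch_l, weak_l1, H. Qed.

Lemma weak_r1 X Y Z : Z ⊩ X -> Z ⊩ X ;; Y.
Proof. intros H; apply disp_gt_l; exact (base1 (b_weak_gt_l (L := L) Z Y X) H). Qed.

Lemma weak_r2 X Y Z : Z ⊩ Y -> Z ⊩ X ;; Y.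
Proof. intros H; apply exch_r, weak_r1, H. Qed.

Lemma top_r X : X ⊩ EFm ETop.
Proof. apply I_weak_l; exact (base0 (b_top_r L)). Qed.

Lemma bot_l X : EFm EBot ⊩ X.
Proof. apply I_weak_r; exact (base0 (b_bot_l L)). Qed.

Lemma and_r A B X : X ⊩ EFm A -> X ⊩ EFm B -> X ⊩ EFm (EAnd A B).
Proof. intros H1 H2; apply contr_l; exact (base2 (b_and_r (L := L) A B X X) H1 H2). Qed.

Lemma and_l A B X : EFm A ;; EFm B ⊩ X -> EFm (EAnd A B) ⊩ X.
Proof. exact (base1 (b_and_l (L := L) A B X)). Qed.

Lemma or_l A B X : EFm A ⊩ X -> EFm B ⊩ X -> EFm (EOr A B) ⊩ X.
Proof. intros H1 H2; apply contr_r; exact (base2 (b_or_l (L := L) A B X X) H1 H2). Qed.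

Lemma or_r A B X : X ⊩ EFm A ;; EFm B -> X ⊩ EFm (EOr A B).
Proof. exact (base1 (b_or_r (L := L) A B X)). Qed.

Lemma imp_r A B X : X ⊩ EFm A > EFm B -> X ⊩ EFm (EImp A B).
Proof. exact (base1 (b_imp_r (L := L) A B X)). Qed.

Lemma imp_l A B X Y : X ⊩ EFm A -> EFm B ⊩ Y -> EFm (EImp A B) ⊩ X > Y.
Proof. exact (base2 (b_imp_l (L := L) A B X Y)). Qed.

Lemma pmi_r A B X : X ⊩ EFm B < EFm A -> X ⊩ EFm (EPmi B A).
Proof. exact (base1 (b_pmi_r (L := L) A B X)). Qed.

Lemma pmi_l A B X Y : EFm B ⊩ Y -> X ⊩ EFm A -> EFm (EPmi B A) ⊩ Y < X.
Proof. exact (base2 (b_pmi_l (L := L) A B X Y)). Qed.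

Lemma succ_l A B X : EFm A > EFm B ⊩ X -> EFm (ESucc A B) ⊩ X.
Proof. exact (base1 (b_succ_l (L := L) A B X)). Qed.

Lemma succ_r A B X Y : EFm A ⊩ X -> Y ⊩ EFm B -> X > Y ⊩ EFm (ESucc A B).
Proof. exact (base2 (b_succ_r (L := L) A B X Y)). Qed.

Lemma prec_l A B X : EFm B < EFm A ⊩ X -> EFm (EPrec B A) ⊩ X.
Proof. exact (base1 (b_prec_l (L := L) A B X)). Qed.

Lemma prec_r A B X Y : Y ⊩ EFm B -> EFm A ⊩ X -> Y < X ⊩ EFm (EPrec B A).
Proof. exact (base2 (b_prec_r (L := L) A B X Y)). Qed.

Lemma dia_l s A X : Mod fwd s (EFm A) ⊩ X -> EFm (EDia s A) ⊩ X.
Proof. apply rule1, e_dia_l. Qed.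

Lemma dia_r s A X : X ⊩ EFm A -> Mod fwd s X ⊩ EFm (EDia s A).
Proof. apply rule1, e_dia_r. Qed.

Lemma box_l s A X : EFm A ⊩ X -> EFm (EBox s A) ⊩ Mod fwd s X.
Proof. apply rule1, e_box_l. Qed.

Lemma box_r s A X : X ⊩ Mod fwd s (EFm A) -> X ⊩ EFm (EBox s A).
Proof. apply rule1, e_box_r. Qed.

Lemma fm_refl A : A ≤ A.
Proof.
  induction A.
  - apply rule0; exact (e_atom R [] [] p).
  - apply bot_l.
  - apply top_r.
  - apply and_l, and_r; [apply weak_l1|apply weak_l2]; assumption.
  - apply or_r, or_l; [apply weak_r1|apply weak_r2]; assumption.
  - apply imp_r, imp_l; assumption.
  - apply pmi_r, pmi_l; assumption.
  - apply succ_l, succ_r; assumption.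
  - apply prec_l, prec_r; assumption.
  - apply dia_l, dia_r; assumption.
  - apply box_r, box_l; assumption.
  - apply (rule1 (e_one_l R α (EFm (EOne α)))), rule0, e_one_r.
Qed.

(** * Boolean laws *)

Lemma and_le1 A B : EAnd A B ≤ A.
Proof. apply and_l, weak_l1, fm_refl. Qed.
Lemma and_le2 A B : EAnd A B ≤ B.
Proof. apply and_l, weak_l2, fm_refl. Qed.
Lemma le_or1 A B : A ≤ EOr A B.
Proof. apply or_r, weak_r1, fm_refl. Qed.
Lemma le_or2 A B : B ≤ EOr A B.
Proof. apply or_r, weak_r2, fm_refl. Qed.

(** Distributivity comes from display: once [A] is moved to the right, the disjunction stands alone
    and can be eliminated. *)
Lemma and_or_distr A B C D : EAnd A B ≤ D -> EAnd A C ≤ D -> EAnd A (EOr B C) ≤ D.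
Proof.
  assert (Hd : forall B', EAnd A B' ≤ D -> EFm B' ⊩ EFm A > EFm D).
  { intros B' H; apply disp_gt_r, cut with (EAnd A B'); [|exact H].
    apply and_r; [apply weak_l1|apply weak_l2]; apply fm_refl. }
  intros HB HC; apply and_l, disp_gt_r, or_l; apply Hd; assumption.
Qed.

Lemma imp_mp A B : EAnd A (EImp A B) ≤ B.
Proof. apply and_l, disp_gt_r, imp_l; apply fm_refl. Qed.

Lemma imp_intro A B : B ≤ EImp A B.
Proof. apply imp_r, disp_gt_r, weak_l2, fm_refl. Qed.

(** Classicality enters here: the Grishin rule turns [(A > B) ;; A] into [A > (B ;; A)], which holds
    by weakening. The case of [EBot] for [B] is excluded middle. *)
Lemma em_str A B : EI ⊩ EFm A ;; EFm (EImp A B).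
Proof.
  apply disp_gt_l, imp_r, disp_gt_l, exch_r.
  apply (display (b2_grishin_r (L := L) (EFm A) (EFm B) (EFm A) EI)).
  apply disp_gt_r; apply weak_l1, weak_r2, fm_refl.
Qed.

Lemma em A B C : C ≤ EOr A (EImp A B).
Proof. apply or_r, I_weak_l, em_str. Qed.

Lemma pmi_imp A B : EPmi B A ≤ EImp A B.
Proof. apply imp_r, disp_gt_r, exch_l, disp_lt_r, pmi_l; apply fm_refl. Qed.

Lemma imp_pmi A B : EImp A B ≤ EPmi B A.
Proof. apply pmi_r, disp_lt_r, exch_l, disp_gt_r, imp_l; apply fm_refl. Qed.

(** [ESucc A B] is the difference of [B] by [A], left adjoint to disjunction with [A]; [le_succ] is
    the unit of the adjunction. *)
Lemma succ_le A B C : B ≤ EOr A C -> ESucc A B ≤ C.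
Proof.
  intros H; apply succ_l, disp_gt_l, cut with (EOr A C); [exact H|].
  apply or_l; [apply weak_r1|apply weak_r2]; apply fm_refl.
Qed.

Lemma le_succ A B : B ≤ EOr A (ESucc A B).
Proof. apply or_r, disp_gt_l, succ_r; apply fm_refl. Qed.

Lemma prec_succ A B : EPrec B A ≤ ESucc A B.
Proof. apply prec_l, disp_lt_l, exch_r, disp_gt_l, succ_r; apply fm_refl. Qed.

Lemma succ_prec A B : ESucc A B ≤ EPrec B A.
Proof. apply succ_l, disp_gt_l, exch_r, disp_lt_l, prec_r; apply fm_refl. Qed.

(** * Modal laws *)

Lemma dia_le s A B : A ≤ B -> EDia s A ≤ EDia s B.
Proof. intros H; apply dia_l, dia_r, H. Qed.

(** On the left [{s}] is left adjoint to [{s}˘], so diamonds preserve finite joins; [dia_or] is the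
    binary case. *)
Lemma dia_bot s A : EDia s EBot ≤ A.
Proof. apply dia_l, mod_disp_l, bot_l. Qed.

Lemma dia_or s A B : EDia s (EOr A B) ≤ EOr (EDia s A) (EDia s B).
Proof.
  apply dia_l, mod_disp_l, or_l; apply mod_disp_l, or_r;
    [apply weak_r1|apply weak_r2]; apply dia_r, fm_refl.
Qed.

(** Conjugation brings the box under [{s}] as [{s}˘[s]A], which entails [A] by adjunction and
    clashes with the negation there. With the dual argument of [box_or_dia_not], [[s]A] and [⟨s⟩¬A]
    are complements. *)
Lemma box_dia_not s A C : EAnd (EBox s A) (EDia s (EImp A EBot)) ≤ C.
Proof.
  apply and_l, exch_l, disp_lt_r, dia_l, disp_lt_r.
  apply (rule1 (e_conj_l R fwd s _ _ _)), mod_disp_l, disp_gt_r.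
  apply cut with A; [apply mod_disp_r, box_l, fm_refl|].
  apply disp_gt_r, exch_l, disp_gt_r, imp_l; [apply fm_refl|apply bot_l].
Qed.

Lemma box_or_dia_not s A C : C ≤ EOr (EBox s A) (EDia s (EImp A EBot)).
Proof.
  apply or_r, disp_lt_l, box_r, disp_lt_l.
  apply (rule1 (e_conj_r R fwd s _ _ _)), mod_disp_r, disp_gt_l; simpl.
  apply cut with (EImp A EBot); [apply disp_gt_l, I_weak_l, em_str|].
  apply mod_disp_l, dia_r, fm_refl.
Qed.

Lemma dia_le_box α A : EDia (LAc α) A ≤ EBox (LAc α) A.
Proof. apply dia_l, box_r, (rule1 (e_balance R α _ _)), fm_refl. Qed.

(** Contraction supplies the second copy of [Φ_α] that comp consumes. With [dia_le_one] this matches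
    the translation of [1_α]. *)
Lemma one_le_dia α : EOne α ≤ EDia (LAc α) ETop.
Proof.
  apply (rule1 (e_one_l R α _)), contr_l, (rule1 (e_comp_l R α _ _)), dia_r, top_r.
Qed.

Lemma dia_le_one α : EDia (LAc α) ETop ≤ EOne α.
Proof. apply dia_l, (rule1 (e_reduce_l R α _ _)), weak_l1, rule0, e_one_r. Qed.

Lemma dia_atom α (p : P) : EDia (LAc α) (EVar p) ≤ EVar p.
Proof. apply dia_l, rule0; exact (e_atom R [(fwd, α)] [] p). Qed.

Lemma atom_box α (p : P) : EVar p ≤ EBox (LAc α) (EVar p).
Proof. apply box_r, rule0; exact (e_atom R [] [(fwd, α)] p). Qed.

Lemma swap_in a α β A : R a α β ->
  EAnd (EOne α) (EDia (LAg a) (EDia (LAc β) A)) ≤ EDia (LAc α) (EDia (LAg a) A).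
Proof.
  intros HR; apply and_l, disp_lt_r, (rule1 (e_one_l R α _)), disp_lt_r, disp_gt_r.
  apply dia_l, mod_disp_l, dia_l, (proj1 (mod_disp_l _ _ _)), disp_gt_r.
  apply (rule1 (e_swap_in_l _ _ HR)); do 2 apply dia_r; apply fm_refl.
Qed.

Lemma eak_repeat_le n X Y : X ⊩ eak_repeat n Y -> X ⊩ Y.
Proof.
  revert X; induction n as [|[|n] IH]; intros X H; [apply I_weak_r, H|exact H|].
  apply contr_r, disp_gt_l, IH, disp_gt_l, H.
Qed.

Lemma swap_out a α l A B : enumerates l (R a α) ->
  (forall β, In β l -> EDia (LAg a) (EDia (LAc β) A) ≤ B) ->
  EDia (LAc α) (EDia (LAg a) A) ≤ B.
Proof.
  intros Hl H; apply dia_l, mod_disp_l, dia_l, (proj1 (mod_disp_l _ _ _)), (@eak_repeat_le (length l)).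
  apply (by_rule (e_swap_out_l _ _ Hl)).
  intros q Hq; apply in_map_iff in Hq; destruct Hq as (β & <- & Hβ).
  apply cut with (EDia (LAg a) (EDia (LAc β) A)); [do 2 apply dia_r; apply fm_refl|auto].
Qed.

(** * The canonical model *)

Definition filter (F : fm -> Prop) : Prop :=
  F ETop /\ (forall A B, A ≤ B -> F A -> F B) /\ (forall A B, F A -> F B -> F (EAnd A B)).

Definition ideal (J : fm -> Prop) : Prop :=
  J EBot /\ (forall A B, A ≤ B -> J B -> J A) /\ (forall A B, J A -> J B -> J (EOr A B)).

Definition prime (F : fm -> Prop) : Prop :=
  filter F /\ ~ F EBot /\ (forall A B, F (EOr A B) -> F A \/ F B).

Lemma and_le_and A B C D : A ≤ C -> B ≤ D -> EAnd A B ≤ EAnd C D.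
Proof.
  intros H1 H2; apply and_r; [apply cut with A; [apply and_le1|exact H1]
                             |apply cut with B; [apply and_le2|exact H2]].
Qed.

(** Prime filter theorem: a filter maximal among those extending [F] and avoiding [J] is prime, by
    distributivity. *)
Lemma prime_filter_exists (F J : fm -> Prop) :
  filter F -> ideal J -> (forall A, F A -> ~ J A) ->
  exists G, prime G /\ (forall A, F A -> G A) /\ (forall A, G A -> ~ J A).
Proof.
  intros (FT & Fup & Fand) (JB & Jdown & Jor) FJ.
  (* The last conjunct is conditional because the union of the empty chain is empty. *)
  set (Q := fun G : fm -> Prop =>
    (forall A, G A -> ~ J A) /\ (forall A B, A ≤ B -> G A -> G B) /\
    (forall A B, G A -> G B -> G (EAnd A B)) /\ (forall A B, G A -> F B -> G B)).
  destruct (@classical_sets.Zorn_bigcup fm Q) as (G & (GJ & Gup & Gand & GF) & Gmax).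
  { intros C CQ Ctot; repeat split.
    - intros A [G CG GA]; exact (proj1 (CQ G CG) A GA).
    - intros A B HAB [G CG GA]; exists G; [exact CG|].
      exact (proj1 (proj2 (CQ G CG)) A B HAB GA).
    - intros A B [G CG GA] [G' CG' GB].
      destruct (Ctot G G' CG CG') as [Hs|Hs].
      + exists G'; [exact CG'|]; apply (CQ G' CG'); [apply Hs, GA|exact GB].
      + exists G; [exact CG|]; apply (CQ G CG); [exact GA|apply Hs, GB].
    - intros A B [G CG GA] FB; exists G; [exact CG|].
      exact (proj2 (proj2 (proj2 (CQ G CG))) A B GA FB). }
  (* Without [ETop] the set [G] would be empty, and [F] would properly extend it. *)
  assert (GT : G ETop).
  { apply NNPP; intros HT; apply (Gmax F).
    - split.
      + intros A GA; exfalso; exact (HT (Gup A ETop (top_r _) GA)).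
      + intros Hs; exact (HT (Hs ETop FT)).
    - repeat split; auto. }
  (* The filter generated by [G] and a new [B] is strictly larger than [G], so by maximality it
     meets [J]. *)
  assert (Hmeet : forall B, ~ G B -> exists g j, G g /\ J j /\ EAnd g B ≤ j).
  { intros B GB; apply NNPP; intros Hno.
    apply (Gmax (fun D => exists g, G g /\ EAnd g B ≤ D)).
    - split.
      + intros A GA; exists A; split; [exact GA|apply and_le1].
      + intros Hs; apply GB, Hs; exists ETop; split; [exact GT|apply and_le2].
    - repeat split.
      + intros A (g & Gg & Hg) JA; apply Hno; eauto.
      + intros A A' HA (g & Gg & Hg); exists g; split; [exact Gg|].
        exact (cut Hg HA).
      + intros A A' (g & Gg & Hg) (g' & Gg' & Hg'); exists (EAnd g g').
        split; [auto|apply and_r].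
        * apply cut with (EAnd g B); [|exact Hg].
          apply and_le_and; [apply and_le1|apply fm_refl].
        * apply cut with (EAnd g' B); [|exact Hg'].
          apply and_le_and; [apply and_le2|apply fm_refl].
      + intros A A' _ FA'; exists A'; split; [exact (GF _ _ GT FA')|apply and_le1]. }
  exists G; split; [|split; [intros A; exact (GF _ _ GT)|exact GJ]].
  split; [repeat split; auto|]; split; [intros GB; exact (GJ _ GB JB)|].
  intros B C GBC; apply NNPP; intros Hno.
  destruct (Hmeet B) as (g & j & Gg & Jj & Hg); [tauto|].
  destruct (Hmeet C) as (g' & j' & Gg' & Jj' & Hg'); [tauto|].
  (* This element of [G] lies below [EOr j j'], which is in [J]. *)
  apply (GJ (EAnd (EAnd g g') (EOr B C))); [auto|].
  apply (Jdown _ (EOr j j')); [|auto].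
  apply and_or_distr.
  - apply cut with (EAnd g B); [apply and_le_and; [apply and_le1|apply fm_refl]|].
    exact (cut Hg (le_or1 _ _)).
  - apply cut with (EAnd g' C); [apply and_le_and; [apply and_le2|apply fm_refl]|].
    exact (cut Hg' (le_or2 _ _)).
Qed.

(** * Worlds, truth and canonical accessibility *)

Definition world : Type := {u : fm -> Prop | prime u}.

Definition holds (u : world) (A : fm) : Prop := proj1_sig u A.

Implicit Types u v w : world.

Definition canon (s : label Ag Ac) (u v : world) : Prop :=
  forall A, holds v A -> holds u (EDia s A).

Lemma holds_le u A B : A ≤ B -> holds u A -> holds u B.
Proof. destruct (proj2_sig u) as ((_ & H & _) & _); apply H. Qed.

Lemma holds_top u : holds u ETop.
Proof. destruct (proj2_sig u) as ((H & _) & _); exact H. Qed.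

Lemma holds_bot u : ~ holds u EBot.
Proof. destruct (proj2_sig u) as (_ & H & _); exact H. Qed.

Lemma holds_and u A B : holds u (EAnd A B) <-> holds u A /\ holds u B.
Proof.
  split; [intros H; split; [exact (holds_le (and_le1 A B) H)|exact (holds_le (and_le2 A B) H)]|].
  destruct (proj2_sig u) as ((_ & _ & H) & _); intros []; apply H; assumption.
Qed.

Lemma holds_or u A B : holds u (EOr A B) <-> holds u A \/ holds u B.
Proof.
  split; [destruct (proj2_sig u) as (_ & _ & H); apply H|].
  intros [H|H]; [exact (holds_le (le_or1 A B) H)|exact (holds_le (le_or2 A B) H)].
Qed.

Lemma holds_imp u A B : holds u (EImp A B) <-> (holds u A -> holds u B).
Proof.
  split.
  - intros H HA; apply (holds_le (imp_mp A B)), holds_and; auto.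
  - intros H; destruct (proj1 (holds_or u A (EImp A B))) as [HA|HA].
    + apply (holds_le (em A B ETop)), holds_top.
    + apply (holds_le (imp_intro A B)); auto.
    + exact HA.
Qed.

Lemma holds_succ u A B : holds u (ESucc A B) <-> holds u B /\ ~ holds u A.
Proof.
  split.
  - intros H; split; [apply (holds_le (succ_le (le_or2 A B)) H)|].
    intros HA; apply (holds_bot (u := u)), (holds_imp u A EBot); [|exact HA].
    apply (holds_le (succ_le (em A EBot B)) H).
  - intros [HB HA]; apply (holds_le (le_succ A B)) in HB; apply holds_or in HB; tauto.
Qed.

(** Prime filters of a Boolean algebra are ultrafilters, so inclusion between them is equality. *)
Lemma world_ext u v : (forall A, holds u A -> holds v A) -> u = v.
Proof.
  intros H; assert (H' : forall A, holds u A <-> holds v A).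
  { intros A; split; [apply H|]; intros HA; apply NNPP; intros HuA.
    apply (holds_bot (u := v)); apply (proj1 (holds_imp v A EBot)); [|exact HA].
    apply H, holds_imp; tauto. }
  destruct u as (F & Hu), v as (G & Hv).
  assert (E : F = G) by (extensionality A; apply propositional_extensionality, H').
  subst G; f_equal; apply proof_irrelevance.
Qed.

(** Since diamonds preserve finite joins, the formulas whose diamond fails at [u] form an ideal; a
    prime filter avoiding it is a successor of [u]. *)
Lemma canon_exists s u (F : fm -> Prop) :
  filter F -> (forall A, F A -> holds u (EDia s A)) ->
  exists v, canon s u v /\ forall A, F A -> holds v A.
Proof.
  intros HF Hu.
  destruct (@prime_filter_exists F (fun A => ~ holds u (EDia s A)) HF) as (G & HG & HFG & HGu).
  - split; [|split].
    + intros H; apply (holds_bot (u := u)); exact (holds_le (dia_bot s EBot) H).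
    + intros A B HAB HB HA; exact (HB (holds_le (dia_le s HAB) HA)).
    + intros A B HA HB H; apply (holds_le (dia_or s A B)), holds_or in H; tauto.
  - auto.
  - exists (exist _ G HG); split; [|exact HFG].
    intros A HA; apply NNPP; exact (HGu A HA).
Qed.

Lemma holds_dia s u A : holds u (EDia s A) <-> exists v, canon s u v /\ holds v A.
Proof.
  split; [intros H|intros (v & Huv & Hv); apply Huv, Hv].
  destruct (@canon_exists s u (fun B => A ≤ B)) as (v & Huv & Hv).
  - split; [apply top_r|split]; [intros B C HBC HB; exact (cut HB HBC)|intros B C; apply and_r].
  - intros B HB; exact (holds_le (dia_le s HB) H).
  - exists v; split; [exact Huv|apply Hv, fm_refl].
Qed.

Lemma holds_box s u A : holds u (EBox s A) <-> forall v, canon s u v -> holds v A.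
Proof.
  assert (Hnot : ~ (holds u (EBox s A) /\ holds u (EDia s (EImp A EBot)))).
  { intros H; apply (holds_bot (u := u)).
    apply (holds_le (box_dia_not s A EBot)), holds_and, H. }
  split.
  - intros H v Huv; apply NNPP; intros HA; apply Hnot; split; [exact H|].
    apply Huv, holds_imp; tauto.
  - intros H; destruct (proj1 (holds_or u _ _)
      (holds_le (box_or_dia_not s A ETop) (holds_top u))) as [HA|HA]; [exact HA|].
    apply holds_dia in HA; destruct HA as (v & Huv & Hv).
    exfalso; apply (holds_bot (u := v)), (proj1 (holds_imp v A EBot) Hv); auto.
Qed.

(** The intermediate world must contain [EDia t A] for every [A] true at [w]; these formulas
    generate the filter to be extended. *)
Lemma canon_comp s t u w :
  (forall A, holds w A -> holds u (EDia s (EDia t A))) ->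
  exists v, canon s u v /\ canon t v w.
Proof.
  intros H.
  destruct (@canon_exists s u (fun B => exists A, holds w A /\ EDia t A ≤ B))
    as (v & Huv & Hv).
  - split; [|split].
    + exists ETop; split; [apply holds_top|apply top_r].
    + intros B C HBC (A & HA & HB); exists A; split; [exact HA|exact (cut HB HBC)].
    + intros B C (A & HA & HB) (A' & HA' & HC); exists (EAnd A A').
      split; [apply holds_and; auto|]; apply and_r.
      * exact (cut (dia_le t (and_le1 A A')) HB).
      * exact (cut (dia_le t (and_le2 A A')) HC).
  - intros B (A & HA & HB); exact (holds_le (dia_le s HB) (H A HA)).
  - exists v; split; [exact Huv|]; intros A HA; apply Hv; exists A.
    split; [exact HA|apply fm_refl].
Qed.

(** * Frame conditions in the canonical model *)

Lemma canon_functional α u v w : canon (LAc α) u v -> canon (LAc α) u w -> v = w.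
Proof.
  intros Huv Huw; apply world_ext; intros A HA.
  apply (proj1 (holds_box (LAc α) u A)); [|exact Huw].
  apply (holds_le (dia_le_box α A)), Huv, HA.
Qed.

Lemma canon_atom α (p : P) u v :
  canon (LAc α) u v -> (holds u (EVar p) <-> holds v (EVar p)).
Proof.
  intros Huv; split; intros H.
  - apply (holds_le (atom_box α p)) in H; exact (proj1 (holds_box _ _ _) H v Huv).
  - apply (holds_le (dia_atom α p)), Huv, H.
Qed.

Lemma canon_swap_in a α β u v w t : R a α β -> canon (LAg a) u v ->
  canon (LAc β) v w -> canon (LAc α) u t ->
  exists v', canon (LAc α) u v' /\ canon (LAg a) v' w.
Proof.
  intros HR Huv Hvw Hut; apply canon_comp; intros A HA.
  apply (holds_le (swap_in A HR)), holds_and; split; [|apply Huv, Hvw, HA].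
  apply (holds_le (dia_le_one α)), Hut, holds_top.
Qed.

Lemma canon_swap_out l a α u v w : enumerates l (R a α) ->
  canon (LAc α) u v -> canon (LAg a) v w ->
  exists β v', R a α β /\ canon (LAg a) u v' /\ canon (LAc β) v' w.
Proof.
  intros Hl Huv Hvw; apply NNPP; intros Hno.
  (* If no β offers a path, [canon_comp] yields for each a formula true at [w] whose double diamond
     fails at [u]. [A] is the meet of these formulas and [B] the join of the failing double
     diamonds, both finite because [l] is. *)
  assert (Hm : forall m, incl m l -> exists A B, holds w A /\ ~ holds u B /\
    forall β, In β m -> EDia (LAg a) (EDia (LAc β) A) ≤ B).
  { induction m as [|β m IH]; intros Hml.
    - exists ETop, EBot; split; [apply holds_top|split; [apply holds_bot|intros _ []]].
    - destruct IH as (A & B & HA & HB & HAB); [intros β' Hβ'; apply Hml; right; exact Hβ'|].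
      destruct (classic (forall A', holds w A' -> holds u (EDia (LAg a) (EDia (LAc β) A'))))
        as [Hall|Hnot].
      + destruct (canon_comp Hall) as (v' & H1 & H2); exfalso; apply Hno.
        exists β, v'; split; [apply Hl, Hml; left; reflexivity|auto].
      + apply not_all_ex_not in Hnot; destruct Hnot as (A' & Hnot).
        apply imply_to_and in Hnot; destruct Hnot as (HA' & HB').
        exists (EAnd A A'), (EOr B (EDia (LAg a) (EDia (LAc β) A'))).
        split; [apply holds_and; auto|]; split; [rewrite holds_or; tauto|].
        intros β' [<-|Hβ'].
        * apply cut with (EDia (LAg a) (EDia (LAc β) A')); [|apply le_or2].
          apply dia_le, dia_le, and_le2.
        * apply cut with (EDia (LAg a) (EDia (LAc β') A)); [apply dia_le, dia_le, and_le1|].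
          exact (cut (HAB β' Hβ') (le_or1 _ _)). }
  destruct (Hm l (incl_refl l)) as (A & B & HA & HB & HAB).
  apply HB, (holds_le (swap_out Hl HAB)), Huv, Hvw, HA.
Qed.

End EAKTheory.

(** * Truth lemma and completeness *)

Lemma canon_truth (P Ag Ac : Type) (R : Ag -> Ac -> Ac -> Prop) (A : eak_fm P Ag Ac)
  (u : world P R) :
  tden R (@canon P Ag Ac R) (fun p u => holds u (EVar p)) (translate A) u <-> holds u A.
Proof.
  revert u; induction A; intros u; simpl.
  - tauto.
  - split; [tauto|intros H; exact (holds_bot H)].
  - split; [intros _; apply holds_top|trivial].
  - rewrite holds_and, IHA1, IHA2; tauto.
  - rewrite holds_or, IHA1, IHA2; tauto.
  - rewrite holds_imp, IHA1, IHA2; tauto.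
  (* [EPmi], like [EPrec] below, is reduced to its interderivable mirror image. *)
  - rewrite IHA1, IHA2, <- holds_imp.
    split; apply holds_le; [apply imp_pmi|apply pmi_imp].
  - rewrite IHA1, IHA2, holds_succ; tauto.
  - rewrite IHA1, IHA2, <- holds_succ.
    split; apply holds_le; [apply succ_prec|apply prec_succ].
  - rewrite holds_dia; destruct s as [a|α]; simpl.
    + split; [intros (d & v & -> & Huv & Hv)|intros (v & Huv & Hv)].
      * exists v; split; [exact Huv|apply IHA, Hv].
      * exists a, v; repeat split; [exact Huv|apply IHA, Hv].
    + split; [intros (d & v & -> & Huv & Hv)|intros (v & Huv & Hv)].
      * exists v; split; [exact Huv|apply IHA, Hv].
      * exists α, v; repeat split; [exact Huv|apply IHA, Hv].
  - rewrite holds_box; destruct s as [a|α]; simpl.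
    + split; [intros H v Huv; apply IHA; exact (H a v eq_refl Huv)|].
      intros H d v -> Huv; apply IHA; exact (H v Huv).
    + split; [intros H v Huv; apply IHA; exact (H α v eq_refl Huv)|].
      intros H d v -> Huv; apply IHA; exact (H v Huv).
  - split.
    + intros (d & v & -> & Huv & _); apply (holds_le (dia_le_one _ _ _)), Huv, holds_top.
    + intros H; apply (holds_le (one_le_dia _ _ _)), holds_dia in H.
      destruct H as (v & Huv & _); exists α, v; auto.
Qed.

(** If [A] does not entail [B], the filter above [A] and the ideal below [B] are disjoint, and a
    prime filter separating them is a countermodel world. *)
Lemma holds_complete (P Ag Ac : Type) (R : Ag -> Ac -> Ac -> Prop) (A B : eak_fm P Ag Ac) :
  (forall u : world P R, holds u A -> holds u B) -> eak_derivable R (EFm A) (EFm B).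
Proof.
  intros H; apply NNPP; intros HAB.
  destruct (@prime_filter_exists P Ag Ac R
    (fun C => eak_derivable R (EFm A) (EFm C)) (fun C => eak_derivable R (EFm C) (EFm B)))
    as (G & HG & HA & HB).
  - split; [apply top_r|split]; [intros C D HCD HC; exact (cut HC HCD)|intros C D; apply and_r].
  - split; [apply bot_l|split]; [intros C D; apply cut|intros C D; apply or_l].
  - intros C HC HC'; exact (HAB (cut HC HC')).
  - apply (HB B (H (exist _ G HG) (HA A (fm_refl R A)))), fm_refl.
Qed.

Unset Implicit Arguments.

Theorem corollary7p6 (P Ag Ac : Type) (R : Ag -> Ac -> Ac -> Prop)
  (R_finite : forall (a : Ag) (α : Ac), exists l : list Ac, enumerates l (R a α))
  (A B : eak_fm P Ag Ac) :
  dc_derivable (Op (translate A)) (Op (translate B)) ->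
  eak_derivable R (EFm A) (EFm B).
Proof.
  intros H; apply holds_complete; intros u Hu.
  apply canon_truth; apply canon_truth in Hu.
  refine (@dc_sound P Ag Ac R (world P R) (@canon P Ag Ac R)
    (fun p u => holds u (EVar p)) _ _ _ _ _ H u Hu).
  - apply canon_functional.
  - intros α p v w; apply canon_atom.
  (* Finiteness of the set of β with α a β enters here. *)
  - intros a α v w t Hvw Hwt; destruct (R_finite a α) as (l & Hl).
    exact (canon_swap_out Hl Hvw Hwt).
  - apply canon_swap_in.
Qed.
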